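(* For all $p,q\in\mathbb{R}$ the Gini mean $\mathscr{G}_{p,q}$ belongs to $\mathcal{GPG}$ and $$\operatorname{ord}^*(\mathscr{G}_{p,q})=\begin{cases}0&\text{if }\min(p,q)\ge0\text{ and }\max(p,q)>0;\\ 1&\text{if }\min(p,q)<0\text{ and }\max(p,q)\le0;\\ \frac12&\text{if }p=q=0;\\ \dfrac{-\min(p,q)}{|p-q|}&\text{if }\min(p,q)<0<\max(p,q).\end{cases}$$
   Context: $\mathbb{R}_+:=(0,\infty)$. For $p,q\in\mathbb{R}$ the Gini mean $\mathscr{G}_{p,q}$ is the function on $\mathbb{R}_+^2$ defined by $$\mathscr{G}_{p,q}(x,y):=\begin{cases}\left(\dfrac{x^p+y^p}{x^q+y^q}\right)^{\frac1{p-q}}&\text{if }p\ne q,\\ \exp\left(\dfrac{x^p\ln x+y^p\ln y}{x^p+y^p}\right)&\text{if }p=q.\end{cases}$$ A (bivariate) mean is an arbitrary function $M\colon\mathbb{R}_+\times\mathbb{R}_+\to\mathbb{R}_+$ with $\min(x,y)\le M(x,y)\le\max(x,y)$ for all $x,y\in\mathbb{R}_+$. It is symmetric if $M(x,y)=M(y,x)$ for all $x,y\in\mathbb{R}_+$, and homogeneous if $M(tx,ty)=tM(x,y)$ for all $x,y,t\in\mathbb{R}_+$. $\mathcal{HS}$ denotes the family of all homogeneous, symmetric means $M\colon\mathbb{R}_+^2\to\mathbb{R}_+$. For $M\in\mathcal{HS}$ the lower order and upper order are the real numbers $$\operatorname{lord}(M):=\sup\Big\{\alpha\in\mathbb{R}\colon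 \limsup_{x\to0^+}\frac{M(x,1)}{x^\alpha}=0\Big\},\qquad \operatorname{uord}(M):=\inf\Big\{\alpha\in\mathbb{R}\colon \liminf_{x\to0^+}\frac{M(x,1)}{x^\alpha}=\infty\Big\}.$$ A mean $M\in\mathcal{HS}$ is of generalized power growth if $\operatorname{lord}(M)=\operatorname{uord}(M)$; $\mathcal{GPG}$ denotes the class of all such means, and for $M\in\mathcal{GPG}$ one sets $\operatorname{ord}^*(M):=\operatorname{lord}(M)=\operatorname{uord}(M)$. *)

(* Defs.v *)
From mathcomp Require Import all_boot all_order all_algebra.
From mathcomp Require Import all_classical all_reals all_analysis.

Set Implicit Arguments.
Unset Strict Implicit.
Unset Printing Implicit Defensive.

Import Order.TTheory GRing.Theory Num.Theory.
Import numFieldNormedType.Exports.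

Local Open Scope classical_set_scope.
Local Open Scope ring_scope.

(* Functions on (0, +oo)^2 are represented by total functions R -> R -> R whose
   values matter only at positive arguments. *)

Definition gini {R : realType} (p q x y : R) : R :=
  if p == q then
    expR ((x `^ p * ln x + y `^ p * ln y) / (x `^ p + y `^ p))
  else ((x `^ p + y `^ p) / (x `^ q + y `^ q)) `^ (p - q)^-1.

(* Positivity of the values follows from the lower bound. *)
Definition is_mean {R : realType} (M : R -> R -> R) : Prop :=
  forall x y : R, 0 < x -> 0 < y ->
    Num.min x y <= M x y /\ M x y <= Num.max x y.

Definition mean_symmetric {R : realType} (M : R -> R -> R) : Prop :=
  forall x y : R, 0 < x -> 0 < y -> M x y = M y x.

Definition mean_homogeneous {R : realType} (M : R -> R -> R) : Prop :=
  forall x y t : R, 0 < x -> 0 < y -> 0 < t -> M (t * x) (t * y) = t * M x y.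

Definition HS {R : realType} (M : R -> R -> R) : Prop :=
  [/\ is_mean M, mean_symmetric M & mean_homogeneous M].

(* The supremum and infimum are taken in the extended reals, where they carry no
   default value; for M in HS both are finite. *)
Definition lord {R : realType} (M : R -> R -> R) : \bar R :=
  ereal_sup [set a%:E | a in
    [set a : R | limf_esup (fun x : R => (M x 1 / x `^ a)%:E) 0^'+ = 0%:E]].

Definition uord {R : realType} (M : R -> R -> R) : \bar R :=
  ereal_inf [set a%:E | a in
    [set a : R | limf_einf (fun x : R => (M x 1 / x `^ a)%:E) 0^'+ = +oo%E]].

Definition GPG {R : realType} (M : R -> R -> R) : Prop :=
  HS M /\ lord M = uord M.

(* Meaningful only for M in GPG, where it also equals uord M. *)
Definition ord_star {R : realType} (M : R -> R -> R) : \bar R := lord M.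

(* Main.v *)
(* If c x^o <= M(x,1) <= C x^o near 0+ for some constants c, C > 0, then
   lord(M) = uord(M) = o.  Gini means satisfy such a bound.  For p <> q, on (0,1]
   one has x^min(p,0) <= x^p + 1 <= 2 x^min(p,0), so the quotient under the
   exponent 1/(p-q) is x^(min(p,0) - min(q,0)) up to a factor 2, whence
   o = (min(p,0) - min(q,0)) / (p - q).  For p = q > 0 the exponent
   x^p ln x / (x^p + 1) is bounded since -1/p <= x^p ln x <= 0; for p = q < 0 it
   is ln x up to a bounded term. *)
Require Import Defs.
From mathcomp Require Import all_boot all_order all_algebra.
From mathcomp Require Import all_classical all_reals all_analysis.
From mathcomp Require Import ring lra.
Import Order.TTheory GRing.Theory Num.Theory.
Import numFieldNormedType.Exports.
Local Open Scope classical_set_scope.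
Local Open Scope ring_scope.

Lemma gt0_powRD {R : realType} (x r s : R) : 0 < x ->
  x `^ (r + s) = x `^ r * x `^ s.
Proof. by move=> x0; rewrite powRD// (gt_eqF x0) implybT. Qed.

Lemma gt0_powRB {R : realType} (x r s : R) : 0 < x ->
  x `^ (r - s) = x `^ r / x `^ s.
Proof. by move=> x0; rewrite gt0_powRD// powRN. Qed.

(** * Bounds on upper and lower limits along a filter *)

Section FilterLimits.
Context {T : choiceType} {X : filteredType T} {R : realType}.
Implicit Types (f : X -> \bar R) (F : set_system X) (a : \bar R).

Lemma limf_esup_le f F a :
  (\forall x \near F, f x <= a)%E -> (limf_esup f F <= a)%E.
Proof.
move=> fa; rewrite limf_esupE; apply: ge_ereal_inf.
exists (ereal_sup [set f x | x in [set x | (f x <= a)%E]])%classic.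
  by exists [set x | (f x <= a)%E]%classic.
by apply: ge_ereal_sup => _ [x /= fxa <-].
Qed.

Lemma limf_esup_ge f F a : ProperFilter F ->
  (\forall x \near F, a <= f x)%E -> (a <= limf_esup f F)%E.
Proof.
move=> PF fa; rewrite limf_esupE; apply: le_ereal_inf_tmp => _ [A FA <-].
have [x [Ax afx]] := filter_ex (filterI FA fa).
by apply: (le_trans afx); apply: ereal_sup_ubound; exists x.
Qed.

Lemma limf_einf_ge f F a : Filter F ->
  (\forall x \near F, a <= f x)%E -> (a <= limf_einf f F)%E.
Proof.
move=> FF fa; rewrite /limf_einf leeNr; apply: limf_esup_le.
by apply: filterS fa => x; rewrite leeN2.
Qed.

Lemma limf_einf_le f F a : ProperFilter F ->
  (\forall x \near F, f x <= a)%E -> (limf_einf f F <= a)%E.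
Proof.
move=> PF fa; rewrite /limf_einf leeNl; apply: limf_esup_ge.
by apply: filterS fa => x; rewrite leeN2.
Qed.

End FilterLimits.

(** * Orders of functions comparable to a power near 0 *)

Section PowerGrowth.
Context {R : realType}.
Implicit Types (M : R -> R -> R) (o c C : R).

Lemma powR_near0_le (r e : R) : 0 < r -> 0 < e ->
  \forall x \near 0^'+, x `^ r <= e.
Proof.
move=> r0 e0; have /cvgrPdist_le/(_ e e0) := powR_cvg0 r0.
by apply: filterS => x; rewrite sub0r normrN ger0_norm ?powR_ge0.
Qed.

(** Division by x^a turns the bounds into multiples of x^(o - a), so comparing a with o decides the
    limit: the set in [lord] is exactly (-oo, o), the one in [uord] is (o, +oo). *)
Lemma powR_growth_orders M o c C : 0 < c ->
  (\forall x \near 0^'+, c * x `^ o <= M x 1 <= C * x `^ o) ->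
  lord M = o%:E /\ uord M = o%:E.
Proof.
move=> c0 HM.
have near01 : \forall x \near (0 : R)^'+, 0 < x <= 1.
  near=> x; apply/andP; split; near: x; first exact: nbhs_right_gt.
  exact: nbhs_right_le.
have Hq a : \forall x \near 0^'+, [/\ 0 < x, x <= 1 &
    c * x `^ (o - a) <= M x 1 / x `^ a <= C * x `^ (o - a)].
  near=> x.
  have /andP[x0 x1] : 0 < x <= 1 by near: x.
  split=> //; rewrite gt0_powRB// !mulrA !ler_pM2r ?invr_gt0 ?powR_gt0//.
  by near: x.
(* Taking a = o in [Hq] makes the powers equal to 1, whence c <= C. *)
have C0 : 0 < C.
  have [x [x0 _ /andP[h1 h2]]] := filter_ex (Hq o).
  move: (le_trans h1 h2); rewrite subrr powRr0 !mulr1; exact: lt_le_trans.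
split.
- rewrite /lord.
  suff -> : [set a | limf_esup (fun x => (M x 1 / x `^ a)%:E) 0^'+ = 0%:E]%classic
            = [set a | a < o]%classic.
    apply/eqP; rewrite eq_le; apply/andP; split.
      by apply: ge_ereal_sup => _ [a /= ao <-]; rewrite lee_fin ltW.
    apply/lee_subgt0Pr => e e0; apply: ereal_sup_ubound.
    by exists (o - e) => //=; rewrite ltrBlDr ltrDl.
  apply/seteqP; split=> a /=.
    (* For o <= a, x^(o - a) >= 1 on (0, 1] keeps the quotient above [c], so its upper limit cannot
       be 0. *)
    move=> lim0; rewrite ltNge; apply/negP => oa.
    have : (c%:E <= 0%:E :> \bar R)%E.
      rewrite -lim0; apply: limf_esup_ge.
      apply: filterS (Hq a) => x [x0 x1 /andP[+ _]]; rewrite lee_fin.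
      apply: le_trans; rewrite ler_peMr ?(ltW c0)//.
      by rewrite -(powRr0 x) ger_powR ?x0// subr_le0.
    by rewrite lee_fin leNgt c0.
  move=> ao; apply/eqP; rewrite eq_le; apply/andP; split; last first.
    apply: limf_esup_ge; apply: filterS (Hq a) => x [x0 x1 /andP[+ _]].
    by rewrite lee_fin; apply: le_trans; rewrite mulr_ge0 ?powR_ge0 ?ltW.
  apply/lee_addgt0Pr => e e0; rewrite add0e; apply: limf_esup_le.
  near=> x; have [x0 x1 /andP[_]] : [/\ 0 < x, x <= 1 &
    c * x `^ (o - a) <= M x 1 / x `^ a <= C * x `^ (o - a)] by near: x.
  rewrite lee_fin => /le_trans; apply.
  rewrite mulrC -ler_pdivlMr//; near: x.
  by apply: powR_near0_le; rewrite ?subr_gt0 ?divr_gt0.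
- rewrite /uord.
  suff -> : [set a | limf_einf (fun x => (M x 1 / x `^ a)%:E) 0^'+ = +oo%E]%classic
            = [set a | o < a]%classic.
    apply/eqP; rewrite eq_le; apply/andP; split; last first.
      by apply: le_ereal_inf_tmp => _ [a /= ao <-]; rewrite lee_fin ltW.
    apply/lee_addgt0Pr => e e0; apply: ereal_inf_lbound.
    by exists (o + e) => //=; rewrite ltrDl.
  apply/seteqP; split=> a /=.
    move=> limy; rewrite ltNge; apply/negP => ao.
    have : (+oo%E <= C%:E :> \bar R)%E.
      rewrite -limy; apply: limf_einf_le.
      apply: filterS (Hq a) => x [x0 x1 /andP[_ h]]; rewrite lee_fin.
      apply: (le_trans h); rewrite ger_pMr//.
      by rewrite -(powRr0 x) ger_powR ?x0// subr_ge0.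
    by rewrite leye_eq.
  move=> oa; apply/eqyP => A A0; apply: limf_einf_ge.
  near=> x; have [x0 x1 /andP[+ _]] : [/\ 0 < x, x <= 1 &
    c * x `^ (o - a) <= M x 1 / x `^ a <= C * x `^ (o - a)] by near: x.
  rewrite lee_fin; apply: le_trans.
  (* The lower bound is c / x^(a - o), which exceeds [A] once x^(a - o) <= c / A. *)
  rewrite -opprB powRN ler_pdivlMr ?powR_gt0// mulrC -ler_pdivlMr//; near: x.
  by apply: powR_near0_le; rewrite ?subr_gt0 ?divr_gt0.
Unshelve. all: by end_near. Qed.

End PowerGrowth.

(** * Gini means are homogeneous symmetric means *)

Section Gini.
Context {R : realType}.
Implicit Types p q x y m t : R.

(** Inverting the quotient and negating the exponent 1/(p - q) cancel out. This allows assuming q <=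
    p later. *)
Lemma gini_swap p q x y : 0 < x -> 0 < y -> gini p q x y = gini q p x y.
Proof.
move=> x0 y0; rewrite /gini eq_sym; have [-> //|npq] := eqVneq q p.
rewrite -(opprB q p) invrN powRN -powR_inv1 ?powR_ge0// powRAC; congr (_ `^ _).
by rewrite powR_inv1 ?divr_ge0 ?addr_ge0 ?powR_ge0// invf_div.
Qed.

Lemma gini_symmetric p q : mean_symmetric (gini p q).
Proof.
move=> x y x0 y0; rewrite /gini; case: (p == q).
  by rewrite (addrC (x `^ p)) (addrC (x `^ p * _)).
by rewrite (addrC (x `^ p)) (addrC (x `^ q)).
Qed.

(** For p = q, ln t splits off additively in the exponent; otherwise t^(p - q) factors out of the
    quotient and its power 1/(p - q) is t. *)
Lemma gini_homogeneous p q : mean_homogeneous (gini p q).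
Proof.
move=> x y t x0 y0 t0; rewrite /gini !(powRM _ (ltW t0) (ltW x0)) !(powRM _ (ltW t0) (ltW y0)).
have [px py tp] : [/\ 0 < x `^ p, 0 < y `^ p & 0 < t `^ p] by rewrite !powR_gt0.
have [qx qy tq] : [/\ 0 < x `^ q, 0 < y `^ q & 0 < t `^ q] by rewrite !powR_gt0.
have [npq|npq] := eqVneq p q.
  rewrite !lnM ?posrE//.
  have -> : (t `^ p * x `^ p * (ln t + ln x) + t `^ p * y `^ p * (ln t + ln y))
      / (t `^ p * x `^ p + t `^ p * y `^ p) =
      ln t + (x `^ p * ln x + y `^ p * ln y) / (x `^ p + y `^ p).
    by field; rewrite -mulrDr mulf_neq0 ?gt_eqF ?addr_gt0.
  by rewrite expRD lnK ?posrE.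
have AB0 : 0 <= (x `^ p + y `^ p) / (x `^ q + y `^ q).
  by rewrite divr_ge0 ?addr_ge0// ltW.
rewrite -!mulrDr -mulf_div -(gt0_powRB _ p q t0) (powRM _ (powR_ge0 _ _) AB0).
by rewrite -powRrM divff ?subr_eq0// powRr1// ltW.
Qed.

Lemma powR_ge_shift p q x m : q <= p -> 0 < m <= x ->
  m `^ (p - q) * x `^ q <= x `^ p.
Proof.
move=> qp /andP[m0 mx]; have x0 := lt_le_trans m0 mx.
rewrite -{2}(subrK q p) (gt0_powRD x)// ler_wpM2r ?powR_ge0//.
by apply: ge0_ler_powR; rewrite ?subr_ge0// nnegrE ltW.
Qed.

Lemma powR_le_shift p q x m : q <= p -> 0 < x <= m ->
  x `^ p <= m `^ (p - q) * x `^ q.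
Proof.
move=> qp /andP[x0 xm]; have m0 := lt_le_trans x0 xm.
rewrite -{1}(subrK q p) (gt0_powRD x)// ler_wpM2r ?powR_ge0//.
by apply: ge0_ler_powR; rewrite ?subr_ge0// nnegrE ltW.
Qed.

(** The quotient is an average of x^(p - q) and y^(p - q) with weights x^q and y^q, hence at least
    m^(p - q) when q <= p; for p = q the exponent averages ln x and ln y. *)
Lemma gini_ge p q x y m : 0 < m -> m <= x -> m <= y -> m <= gini p q x y.
Proof.
move=> m0 mx my; have [x0 y0] := (lt_le_trans m0 mx, lt_le_trans m0 my).
wlog qp : p q / q <= p => [H|].
  by have [/H//|/ltW/H] := leP q p; rewrite gini_swap.
have S r : 0 < x `^ r + y `^ r by rewrite addr_gt0 ?powR_gt0.
rewrite /gini; case: eqVneq => [_|npq].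
  rewrite -[leLHS](lnK m0) ler_expR ler_pdivlMr// mulrC mulrDl.
  by rewrite lerD// ler_pM2l ?powR_gt0// ler_ln.
have s0 : 0 < p - q by rewrite subr_gt0 lt_def npq.
rewrite -[leLHS](powRr1 (ltW m0)) -(divff (lt0r_neq0 s0)) powRrM.
apply: ge0_ler_powR; rewrite ?nnegrE ?divr_ge0 ?powR_ge0 ?invr_ge0 ?(ltW (S _)) ?(ltW s0)//.
by rewrite ler_pdivlMr// mulrDr lerD// powR_ge_shift// m0.
Qed.

Lemma gini_le p q x y m : 0 < x -> 0 < y -> x <= m -> y <= m ->
  gini p q x y <= m.
Proof.
move=> x0 y0 xm ym; have m0 := lt_le_trans x0 xm.
wlog qp : p q / q <= p => [H|].
  by have [/H//|/ltW/H] := leP q p; rewrite gini_swap.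
have S r : 0 < x `^ r + y `^ r by rewrite addr_gt0 ?powR_gt0.
rewrite /gini; case: eqVneq => [_|npq].
  rewrite -[leRHS](lnK m0) ler_expR ler_pdivrMr// mulrDr.
  by rewrite ![ln m * _]mulrC lerD// ler_pM2l ?powR_gt0// ler_ln.
have s0 : 0 < p - q by rewrite subr_gt0 lt_def npq.
rewrite -[leRHS](powRr1 (ltW m0)) -(divff (lt0r_neq0 s0)) powRrM.
apply: ge0_ler_powR; rewrite ?nnegrE ?divr_ge0 ?powR_ge0 ?invr_ge0 ?(ltW (S _)) ?(ltW s0)//.
by rewrite ler_pdivrMr// mulrDr lerD// powR_le_shift ?x0 ?y0.
Qed.

Lemma gini_HS p q : HS (gini p q).
Proof.
split; [|exact: gini_symmetric|exact: gini_homogeneous].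
move=> x y x0 y0; split.
  by apply: gini_ge; rewrite ?lt_min ?x0 ?ge_min ?lexx ?orbT.
by apply: gini_le; rewrite ?le_max ?lexx ?orbT.
Qed.

(** * Growth of Gini means near 0 *)

Lemma powRD1_bounds p x : 0 < x <= 1 ->
  x `^ Num.min p 0 <= x `^ p + 1 <= 2 * x `^ Num.min p 0.
Proof.
(* On (0, 1] the larger of x^p and 1 is x^min(p, 0), and a sum of two positive terms lies between
   the larger one and its double. *)
move=> x01; have xp := powR_ge0 x p; case: (leP p 0) => p0.
  have : 1 <= x `^ p by rewrite -(powRr0 x) ger_powR.
  by move=> ?; apply/andP; split; lra.
have : x `^ p <= 1 by rewrite -[leRHS](powRr0 x) ger_powR// ltW.
by rewrite powRr0 => ?; apply/andP; split; lra.
Qed.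

(** Off the diagonal this is the slope of t |-> min(t, 0) between q and p; on it, the derivative,
    completed at 0 by 1/2 because the mean of x and 1 is then the square root of x. *)
Definition gini_order p q : R :=
  if p == q then (if p < 0 then 1 else if p == 0 then 1 / 2 else 0)
  else (Num.min p 0 - Num.min q 0) / (p - q).

Lemma gini_order_swap p q : gini_order p q = gini_order q p.
Proof.
rewrite /gini_order eq_sym; have [->//|npq] := eqVneq q p.
by rewrite -(opprB q p) -(opprB (Num.min q 0)) invrN mulrNN.
Qed.

(** Numerator and denominator each match a power of x up to a factor in [1, 2], so the quotient does
    up to a factor in [1/2, 2]. Since q < p, raising to 1/(p - q) preserves the inequalities. *)
Lemma gini_growth_lt p q x : q < p -> 0 < x <= 1 ->
  2^-1 `^ (p - q)^-1 * x `^ gini_order p q <= gini p q x 1 <=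
  2 `^ (p - q)^-1 * x `^ gini_order p q.
Proof.
move=> qp x01; have /andP[x0 x1] := x01.
rewrite /gini_order /gini gt_eqF// !powR1 powRrM.
have [/andP[p1 p2] /andP[q1 q2]] := (powRD1_bounds p _ x01, powRD1_bounds q _ x01).
rewrite -!powRM ?powR_ge0 ?invr_ge0//.
have a0 := powR_gt0 (Num.min p 0) x0; have b0 := powR_gt0 (Num.min q 0) x0.
have B0 := lt_le_trans b0 q1; have A0 := lt_le_trans a0 p1.
rewrite gt0_powRB//; apply/andP; split;
  apply: ge0_ler_powR;
  rewrite ?nnegrE ?mulr_ge0 ?divr_ge0 ?invr_ge0 ?subr_ge0 ?(ltW qp)
    ?(ltW A0) ?(ltW B0) ?(ltW a0) ?(ltW b0)//.
  rewrite ler_pdivlMr//; apply: (le_trans _ p1).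
  rewrite mulrCA -!mulrA ler_piMr ?(ltW a0)//.
  by rewrite !ler_pdivrMl// mulr1 mulrC.
rewrite ler_pdivrMr//; apply: (le_trans p2).
by rewrite -!mulrA ler_pM2l// ler_peMr ?(ltW a0)// mulrC ler_pdivlMr// mul1r.
Qed.

Lemma powR_ln_ge p x : 0 < p -> 0 < x -> - p^-1 <= x `^ p * ln x.
Proof.
move=> p0 x0; have xp := powR_gt0 p x0.
(* ln u < u at u = x^(-p) *)
have := ln_sublinear (powR_gt0 (- p) x0); rewrite ln_powR powRN => h.
rewrite lerNl -mulrN -(ler_pM2l p0) divff ?gt_eqF//.
rewrite mulrCA mulrN -mulNr mulrC -ler_pdivlMr// div1r; exact: ltW.
Qed.

Lemma gini_growth_diag p : exists2 K : R, 0 < K & forall x, 0 < x <= 1 ->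
  K^-1 * x `^ gini_order p p <= gini p p x 1 <= K * x `^ gini_order p p.
Proof.
(* In logarithms, the exponent of the mean must be within 1/|p| of the order times ln x. At p = 0
   the convention 0^-1 = 0 gives K = 1, and both bounds are equalities. *)
exists (expR `|p|^-1); first exact: expR_gt0.
move=> x /andP[x0 x1]; rewrite /gini_order /gini !eqxx !powR1 ln1 mulr0 addr0.
have lnx : ln x <= 0 by exact: ln_le0.
have xp := powR_gt0 p x0.
have xpow r : x `^ r = expR (r * ln x) by rewrite /powR gt_eqF.
rewrite xpow -expRN -!expRD !ler_expR.
case: (ltgtP p 0) => p0.
- rewrite ltr0_norm// mul1r.
  have pN : 0 < - p by rewrite oppr_gt0.
  have := powR_ln_ge _ _ pN x0; rewrite powRN => h.
  (* With u = x^(-p) the exponent is ln x / (1 + u), that is ln x minus a correction, which u ln x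
     >= 1/p and 1 + u > 1 confine to [1/p, 0]. *)
  set u := (x `^ p)^-1 in h; have u0 : 0 < u by rewrite invr_gt0.
  have -> : x `^ p * ln x / (x `^ p + 1) = ln x - u * ln x / (1 + u).
    by rewrite /u; field; rewrite !gt_eqF// addr_gt0.
  have : - (- p)^-1 <= u * ln x / (1 + u) <= 0.
    apply/andP; split; last by rewrite ler_pdivrMr ?mul0r; nra.
    rewrite ler_pdivlMr; last lra.
    have : 0 < (- p)^-1 by rewrite invr_gt0.
    nra.
  have : 0 < (- p)^-1 by rewrite invr_gt0.
  by move=> ? /andP[? ?]; apply/andP; split; lra.
- rewrite gtr0_norm// mul0r !addr0.
  have h := powR_ln_ge _ _ p0 x0.
  have : 0 < p^-1 by rewrite invr_gt0.
  move=> i0; apply/andP; split; first by rewrite ler_pdivlMr; nra.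
  by rewrite ler_pdivrMr; nra.
- by rewrite p0 normr0 invr0 powRr0 oppr0 !add0r !mul1r mulrC lexx.
Qed.

Lemma gini_orders p q :
  lord (gini p q) = (gini_order p q)%:E /\ uord (gini p q) = (gini_order p q)%:E.
Proof.
have near01 : \forall x \near (0 : R)^'+, 0 < x <= 1.
  near=> x; apply/andP; split; near: x; first exact: nbhs_right_gt.
  exact: nbhs_right_le.
case: (ltgtP p q) => [pq|qp|->].
- apply: (@powR_growth_orders _ _ _ (2^-1 `^ (q - p)^-1) (2 `^ (q - p)^-1)).
    by rewrite powR_gt0.
  near=> x; have x01 : 0 < x <= 1 by near: x.
  have /andP[x0 _] := x01.
  by rewrite gini_swap// gini_order_swap gini_growth_lt.
- apply: (@powR_growth_orders _ _ _ (2^-1 `^ (p - q)^-1) (2 `^ (p - q)^-1)).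
    by rewrite powR_gt0.
  by near=> x; apply: gini_growth_lt => //; near: x.
- have [K K0 HK] := gini_growth_diag q.
  apply: (@powR_growth_orders _ _ _ K^-1 K); first by rewrite invr_gt0.
  by near=> x; apply: HK; near: x.
Unshelve. all: by end_near. Qed.

End Gini.

Theorem proposition4p5 (R : realType) (p q : R) :
  GPG (gini p q) /\
  [/\ (0 <= Num.min p q /\ 0 < Num.max p q -> ord_star (gini p q) = 0%:E),
      (Num.min p q < 0 /\ Num.max p q <= 0 -> ord_star (gini p q) = 1%:E),
      (p = 0 /\ q = 0 -> ord_star (gini p q) = (1 / 2)%:E) &
      (Num.min p q < 0 /\ 0 < Num.max p q ->
         ord_star (gini p q) = (- Num.min p q / `|p - q|)%:E)].
Proof.
have [ordl ordu] := gini_orders p q; rewrite /GPG /ord_star ordl ordu.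
split; first by split; [exact: gini_HS|].
(* The order and the four cases are invariant under exchanging p and q; with q <= p the minimum is q
   and the maximum p. *)
clear ordl ordu; wlog qp : p q / q <= p => [H|].
  have /orP[/H//|/H] := le_total q p.
  rewrite gini_order_swap minC maxC distrC => -[h1 h2 h3 h4].
  by split=> // -[p0 q0]; apply: h3.
rewrite (min_idPr qp) (max_idPl qp) /gini_order.
split.
- move=> [q0 p0]; rewrite [p < 0]ltNge (ltW p0)/= (gt_eqF p0).
  by rewrite (min_idPr (ltW p0)) (min_idPr q0) subrr mul0r if_same.
- move=> [q0 p0]; rewrite (min_idPl p0) (min_idPl (ltW q0)).
  case: eqVneq => [->|npq]; first by rewrite q0.
  by rewrite divff// subr_eq0.
- by move=> [-> ->]; rewrite eqxx ltxx.
- move=> [q0 p0]; have pq := lt_trans q0 p0; rewrite gt_eqF//.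
  by rewrite (min_idPr (ltW p0)) (min_idPl (ltW q0)) sub0r gtr0_norm ?subr_gt0.
Qed.
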